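(* Fix $r\ge 2$ and let $z_m$, $z_m^{(j)}$ be as in the context. When $\frac{r^2}{r+1}\operatorname{Res}(Q^{(r+1)/r})$ is written as a polynomial in the variables $z_m^{(j)}$ ($0\le m\le r-2$, $j\ge 0$), it has the form $$\frac{r^2}{r+1}\operatorname{Res}(Q^{(r+1)/r})=\frac{1}{2}\sum_{j=0}^{r-2}z_jz_{r-2-j}+W_r(z),$$ where every monomial of $W_r(z)$ contains at least one factor $z_m^{(j)}$ with $j\ge 1$.
   Context: Let $R$ be the differential algebra over $\mathbb C$ of polynomials in formal variables $\gamma_0,\dots,\gamma_{r-2}$ and all their $x$-derivatives, with derivation $\partial=\partial/\partial x$. Put $D=\frac{\sqrt{-1}}{\sqrt r}\partial$. Formal pseudodifferential operators are sums $\sum_{i\le N}a_iD^i$ with $a_i\in R$, multiplied using $D^k\cdot f=\sum_{j\ge0}\binom{k}{j}(D^jf)D^{k-j}$ for $k\in\mathbb Z$ (with $\binom{-a-1}{b}=(-1)^b\binom{a+b}{b}$). Let $Q=D^r+\sum_{i=0}^{r-2}\gamma_iD^i$. There is a unique $Q^{1/r}=D+\sum_{i\ge1}w_{-i}D^{-i}$ with $(Q^{1/r})^r=Q$; set $Q^{k/r}=(Q^{1/r})^k$, and let $\operatorname{Res}$ denote the coefficient of $D^{-1}$. For $0\le m\le r-2$ put $z_m=-\frac{r}{m+1}\operatorname{Res}(Q^{(m+1)/r})$ and $z_m^{(j)}=\partial^jz_m$. Each $\gamma_i$ is a differential polynomial in $z_0,\dots,z_{r-2}$, and the $z_m^{(j)}$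 are algebraically independent generators of $R$, so each element of $R$ is uniquely a polynomial in the $z_m^{(j)}$. $W_r(z)$ is defined as $\frac{r^2}{r+1}\operatorname{Res}(Q^{(r+1)/r})-\frac12\sum_{j=0}^{r-2}z_jz_{r-2-j}$ written in the $z_m^{(j)}$. *)

(* Defs.v *)
From HB Require Import structures.
From mathcomp Require Import all_boot all_algebra.
From mathcomp Require Import finmap.
From mathcomp.multinomials Require Import monalg.

Set Implicit Arguments.
Unset Strict Implicit.
Unset Printing Implicit Defensive.

Import GRing.Theory Num.Theory.
Local Open Scope ring_scope.

(* Index set of the variables: (i, j) stands for gamma_i^{(j)},
   0 <= i <= r-2, j >= 0.  The same index set (m, j) is used for the
   variables z_m^{(j)} of the polynomial ring in which W_r lives. *)
Notation Var r := ('I_r.-1 * nat)%type.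

Notation Rg C r := {malg C[{cmonom (Var r)}]}.

Section DiffAlg.
Variables (C : numClosedFieldType) (r : nat).

Definition gvar (v : Var r) : Rg C r := << (1 : C) *g ucm v >>.

Definition gamma (i : nat) : Rg C r :=
  oapp (fun o : 'I_r.-1 => gvar (o, 0%N)) 0 (insub i).

(* derivative of a monomial, by the Leibniz rule, with
   d gamma_i^{(j)} = gamma_i^{(j+1)} *)
Definition dmon (m : cmonom (Var r)) : Rg C r :=
  \sum_(v <- finsupp m)
     (m v)%:R * (<< (1 : C) *g divcm m (ucm v) >> * gvar (v.1, v.2.+1)).

Definition deriv (p : Rg C r) : Rg C r :=
  \sum_(k <- msupp p) p@_k *: dmon k.

Definition derivn (n : nat) (p : Rg C r) : Rg C r := iter n deriv p.

Definition Dapp (l : nat) (p : Rg C r) : Rg C r :=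
  (('i / sqrtC r%:R) ^+ l) *: derivn l p.

Definition binomZ (k : int) (l : nat) : C :=
  (\prod_(i < l) ((k - i%:Z)%:~R : C)) / (l`!)%:R.

(* formal pseudodifferential operator  sum_{k >= 0} pcoef k * D^(pdeg - k) *)
Record PDO := MkPDO { pdeg : int; pcoef : nat -> Rg C r }.

Definition coefZ (A : PDO) (n : int) : Rg C r :=
  if n <= pdeg A then pcoef A (absz (pdeg A - n)) else 0.

(* product, using D^k f = sum_j binom(k,j) (D^j f) D^(k-j) *)
Definition pmul (A B : PDO) : PDO :=
  MkPDO (pdeg A + pdeg B)
    (fun n => \sum_(p < n.+1) \sum_(q < (n - p).+1)
       pcoef A p * (binomZ (pdeg A - p%:Z) (n - p - q)%N
                      *: Dapp (n - p - q)%N (pcoef B q))).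

Definition pone : PDO := MkPDO 0 (fun n => if n == 0%N then 1 else 0).

Definition ppow (A : PDO) (k : nat) : PDO := iter k (pmul A) pone.

Definition Qop : PDO :=
  MkPDO r%:Z (fun k => if k == 0%N then 1
                       else if (1 < k <= r)%N then gamma (r - k) else 0).

Definition res (A : PDO) : Rg C r := coefZ A (-1).

Definition is_Qroot (L : PDO) : Prop :=
  [/\ coefZ L 1 = 1,
      (forall n : int, 0 <= n -> n != 1 -> coefZ L n = 0) &
      (forall n : int, coefZ (ppow L r) n = coefZ Qop n)].

Definition zz (L : PDO) (m : nat) : Rg C r :=
  - ((r%:R / (m.+1)%:R : C)) *: res (ppow L m.+1).

Definition evz (L : PDO) (P : Rg C r) : Rg C r :=
  \sum_(k <- msupp P)
     P@_k *: \prod_(v <- finsupp k) (derivn v.2 (zz L v.1)) ^+ (k v).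

End DiffAlg.

(* Main.v *)
From Pilot Require Import Defs.
From HB Require Import structures.
From mathcomp Require Import all_boot all_algebra.
From mathcomp Require Import finmap.
From mathcomp.multinomials Require Import monalg.
From mathcomp Require Import zify ring.
Import GRing.Theory Num.Theory.
Import Pilot.Defs.
Local Open Scope ring_scope.

(** Write Q^{1/r} = D + sum_i w_i D^{-i}.  The coefficient of D^{-1} in
    Q^{(m+1)/r} is (m+1) w_{m+1} plus a differential polynomial in the earlier
    w's, and likewise the coefficients of Q are r w_i plus earlier terms; hence
    every element of R is a differential polynomial in the z_m.  So the elements
    expressible with a derivative in every monomial form an ideal, it contains
    the image of the derivation, and R modulo it is R modulo the gamma^{(j)},
    j >= 1.  Modulo these, D commutes with everything and Q^{1/r} becomes a
    Laurent series l(p) = p + sum_i w_i p^{-i} with l^r polynomial.  With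
    c_k = Res l^k one has p = l - sum_k (c_k / k) l^{-k} (Lagrange inversion),
    and the coefficient of p^{-1} in p * l^r, which vanishes because l^r is a
    polynomial, gives c_{r+1} as a quadratic form in the other c_k. *)

(** * Lagrange inversion for a commutative Laurent series *)

Lemma coef_Xderiv (R : nzRingType) (p : {poly R}) n : ('X * p^`())`_n = p`_n *+ n.
Proof. by rewrite coefXM; case: n => [|n] //=; rewrite coef_deriv. Qed.

Section Dispersionless.
Variables (K : numFieldType) (A : comAlgType K) (g : {poly A}).
Hypotheses (g0 : g`_0 = 1) (g1 : g`_1 = 0).

(* With u = 1/p, the symbol is l = g(u) / u, so that [powres k] is the residue
   of l^k and (g - u g') is dl/dp. *)
Definition powres (k : nat) : A := (g ^+ k)`_k.+1.

(* The coefficients in p = sum_i (invcoef i) l^(1-i); for i = 1 the value is 0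
   because of the convention 0^-1 = 0. *)
Definition invcoef (i : nat) : A :=
  if i is k.+1 then - (k%:R^-1 : K) *: powres k else 1.
Arguments invcoef : simpl never.

Lemma invcoef1 : invcoef 1 = 0.
Proof. by rewrite /invcoef invr0 oppr0 scale0r. Qed.

(** Follows from u (g^(j+1))' = (j+1) u g^j g'. At n = j+1 the left side is the residue of l^j dl,
    and the factor on the right vanishes: an exact differential has no residue. *)
Lemma coef_expM_deriv j n :
  (g ^+ j * (g - 'X * g^`()))`_n =
    ((j.+1%:R - n%:R) / j.+1%:R : K) *: (g ^+ j.+1)`_n.
Proof.
have j0 : (j.+1%:R : K) != 0 by rewrite pnatr_eq0.
apply: (scalerI j0); rewrite scalerA mulrCA divff // mulr1 scalerBl !scaler_nat.
rewrite -[(g ^+ j.+1)`_n *+ n]coef_Xderiv deriv_exp /= -!coefMn -coefB.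
congr ((_ : {poly A})`_n); rewrite exprS; ring.
Qed.

(* Multiplied by u^-(m+1), this is the expansion of p l^m in powers of l,
   truncated so that no negative power of l is needed.  In the step from m to
   m+1 the single new coefficient is found by taking the residue against dl,
   which kills every l^j dl with j >= 0. *)
Lemma invcoef_expansion m : exists h : {poly A},
  g ^+ m = \sum_(i < m.+2) (invcoef i)%:P * (g ^+ (m.+1 - i) * 'X^i)
           + 'X^(m.+2) * ((invcoef m.+2)%:P + 'X * h).
Proof.
have polyX (p : {poly A}) : {q | p = (p`_0)%:P + 'X * q}.
  exists (drop_poly 1 p); apply/polyP => -[|n].
    by rewrite coefD coefC coefXM /= addr0.
  by rewrite coefD coefC coefXM /= coef_drop_poly add0r addn1.
have [q] := polyX g; have [h] := polyX q; move=> -> gE.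
have q0 : q`_0 = 0.
  by move: g1; rewrite {1}gE coefD coefC coefXM /= add0r coefD coefC coefXM addr0.
rewrite g0 q0 polyC0 add0r in gE.
have e0 : (g - 'X * g^`())`_0 = 1.
  by rewrite coefB coefXM g0 subr0.
have e1 : (g - 'X * g^`())`_1 = 0.
  by rewrite coefB coef_Xderiv g1 mul0rn subr0.
elim: m => [|m [k IH]].
  have [h' hE] := polyX h.
  exists (- h').
  rewrite !big_ord_recl big_ord0 /= /bump /= invcoef1 polyC0 !(mul0r, addr0).
  rewrite polyC1 expr1 mulr1 mul1r /invcoef /powres invr1 scaleNr scale1r expr1.
  have -> : g`_2 = h`_0.
    by rewrite gE coefD coefC coefXM /= coefXM /= add0r.
  by move: (h`_0) hE => c hE; rewrite gE hE polyCN polyC1 expr0; ring.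
(* Multiplying by g = 1 + u^2 h raises each power of g in the sum and leaves the remainder's
   coefficient of u^(m+2) unchanged. The constant [e] split off below is the new coefficient, at
   u^(m+3). *)
have {}IH : g ^+ m.+1 = \sum_(i < m.+2) (invcoef i)%:P * (g ^+ (m.+2 - i) * 'X^i)
    + 'X^(m.+2) * (invcoef m.+2)%:P + 'X^(m.+3) * (k + 'X * h * ((invcoef m.+2)%:P + 'X * k)).
  rewrite exprSr {1}IH mulrDl big_distrl /= -addrA; congr (_ + _).
    apply: eq_bigr => i _; rewrite [in RHS]subSn; last by rewrite -ltnS.
    by rewrite exprSr; ring.
  rewrite {1}gE polyC1 !exprS; ring.
have [k' kE] := polyX (k + 'X * h * ((invcoef m.+2)%:P + 'X * k)).
rewrite {}kE in IH; set e := (k + _)`_0 in IH.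
suff eE : e = invcoef m.+3.
  by exists k'; rewrite big_ord_recr /= subnn expr0 mul1r -eE {1}IH ['X^_ * _%:P]mulrC.
(* Residue against dl: each summand vanishes by [coef_expM_deriv]. Since g - u g' has constant term
   1 and no linear term, the u^(m+2) term drops out and exactly [e] remains. *)
have := congr1 (fun p : {poly A} => (p * (g - 'X * g^`()))`_m.+3) IH.
rewrite coef_expM_deriv -[m.+3%:R]natr1 opprD addNKr mulN1r => lhsE.
rewrite -[invcoef m.+3]/(- m.+2%:R^-1 *: (g ^+ m.+2)`_m.+3) lhsE.
rewrite !mulrDl !coefD big_distrl coef_sum big1 ?add0r; last first.
  move=> i _ /=; rewrite -!mulrA coefCM [_ * (g - _)]mulrC mulrA coefMXn.
  case: ifP => _; rewrite ?mulr0 // coef_expM_deriv [(m.+3 - i)%N]subSn; last exact: ltnW.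
  by rewrite subrr mul0r scale0r mulr0.
rewrite -(mulrA 'X^(m.+2)) -(mulrA 'X^(m.+3)).
rewrite !coefXnM ltnNge leqnSn ltnn subSnn subnn /= coefCM e1 mulr0 add0r.
by rewrite mulrDl coefD coefCM e0 mulr1 -mulrA coefXM /= addr0.
Qed.

(** The hypothesis says that p l^r has residue zero. The coefficient of u^(r+2) in
    [invcoef_expansion] at m = r then gives (1 - 1/(r+1)) [powres] (r+1) = [S], where the 1/(r+1)
    comes from [invcoef] (r+2). *)
Lemma powres_quadratic s (r := s.+2) : (g ^+ r)`_r.+2 = 0 ->
  ((r ^ 2)%:R / r.+1%:R : K) *: powres r.+1 =
  2^-1 *: \sum_(j < s.+1) (- (r%:R / j.+1%:R : K) *: powres j.+1) *
                          (- (r%:R / (s - j).+1%:R : K) *: powres (s - j).+1).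
Proof.
have nz n : (n.+1%:R : K) != 0 by rewrite pnatr_eq0.
pose S := \sum_(j < s.+1) (j.+1%:R^-1 : K) *: (powres j.+1 * powres (s - j).+1).
move=> gr0; have [h /(congr1 (fun p : {poly A} => p`_r.+2))] := invcoef_expansion r.
rewrite {}gr0 coefD coefXnM ltnn subnn coefD coefC coefXM /= addr0 coef_sum.
rewrite (eq_bigr (fun i : 'I_r.+2 => invcoef i * powres (r.+1 - i))); last first.
  move=> i _; rewrite coefCM coefMXn ltnNge (ltnW (ltn_ord i)) /=.
  by rewrite /powres [(r.+2 - i)%N]subSn // -ltnS.
rewrite 2!big_ord_recl /= /bump /= subn0.
rewrite addn0 invcoef1 mul0r add0r big_ord_recr /= subSS.
(* The last term, i = r+1, carries the residue of l^0 = 1. *)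
have -> : powres (r - (1 + s.+1)) = 0 by rewrite add1n subnn /powres expr0 coef1.
rewrite mulr0 addr0.
have -> : \sum_(i < s.+1) invcoef (1 + (1 + i)) * powres (r.+1 - (1 + (1 + i))) = - S.
  rewrite /S -sumrN; apply: eq_bigr => i _; rewrite !add1n !subSS subSn -1?ltnS //.
  by rewrite /invcoef -scalerAl scaleNr.
rewrite {1}/invcoef mul1r {1}/invcoef scaleNr => /eqP.
rewrite eq_sym addrAC subr_eq0 -[X in X - _]scale1r -scalerBl => /eqP SE.
transitivity (r%:R *: S : A).
  rewrite -SE scalerA; congr (_ *: _); rewrite natrX -[in RHS]natr1; field.
  by rewrite natr1.
transitivity (2^-1 *: (r%:R *: (S + S)) : A).
  by rewrite -mulr2n -scaler_nat !scalerA; congr (_ *: _); field.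
(* Symmetrize under j -> s - j: since r = s+2, 1/(j+1) + 1/(s-j+1) = r / ((j+1)(s-j+1)). *)
congr (_ *: _); rewrite {2}/S (reindex_inj rev_ord_inj) /= /S -big_split scaler_sumr.
apply: eq_bigr => j _ /=; rewrite subSS subKn -1?ltnS // [powres (s - j).+1 * _]mulrC.
rewrite -scalerDl -scalerAl -scalerAr !scalerA; congr (_ *: _).
have -> : (r%:R : K) = j.+1%:R + (s - j).+1%:R.
  by rewrite -natrD /r; congr (_%:R); have := ltn_ord j; lia.
by move: j.+1%:R (s - j).+1%:R (nz j) (nz (s - j)%N) => x y x0 y0; field; apply/andP.
Qed.

Lemma powres_pair r : (2 <= r)%N -> (g ^+ r)`_r.+2 = 0 ->
  ((r ^ 2)%:R / r.+1%:R : K) *: powres r.+1 =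
  2^-1 *: \sum_(j < r.-1) (- (r%:R / j.+1%:R : K) *: powres j.+1) *
                          (- (r%:R / (r - 2 - j).+1%:R : K) *: powres (r - 2 - j).+1).
Proof.
case: r => [|[|s]] // _ gr0; rewrite powres_quadratic //; congr (_ *: _).
by apply: eq_bigr => j _; rewrite !subSS subn0.
Qed.
End Dispersionless.

(* In the proofs below about [Rg C r], elements are generalized to variables
   before rewriting, since otherwise unification unfolds the finitely supported
   functions and diverges. *)
Lemma malgUE (K : monomType) (R : nzRingType) (c : R) (k : K) :
  << c *g k >> = c *: << (1 : R) *g k >> :> {malg R[K]}.
Proof. by apply/malgP => k'; rewrite mcoeffZ !mcoeffU mulrnAr mulr1. Qed.

(** * Substitution homomorphisms on the ring of differential polynomials *)

Section Evaluation.
Variables (C : numClosedFieldType) (r : nat).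
Implicit Types (F : Var r -> Rg C r) (k : cmonom (Var r)) (p : Rg C r).

Definition mon k : Rg C r := << (1 : C) *g k >>.

Lemma mon1 : mon mone = 1. Proof. exact: mpolyC1E. Qed.

Lemma monM k1 k2 : mon (mmul k1 k2) = mon k1 * mon k2.
Proof. by rewrite malgM_def fgmulUU mulr1. Qed.

Lemma malgE_mon p : p = \sum_(k <- msupp p) p@_k *: mon k.
Proof.
by rewrite {1}[p]monalgE; apply: eq_bigr => k _; exact: malgUE.
Qed.

Definition eval_mon F k : Rg C r := \prod_(v <- finsupp k) F v ^+ k v.

Lemma mon_ind (S : Rg C r -> Prop) :
  (forall k, S (mon k)) -> (forall c p, S p -> S (c *: p)) ->
  (forall p q, S p -> S q -> S (p + q)) -> forall p, S p.
Proof.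
move=> Smon SZ SD p; rewrite [p]malgE_mon; elim/big_ind: _ => [||k _].
- by rewrite -(scale0r (mon mone)); exact: SZ.
- exact: SD.
- exact: SZ.
Qed.

Lemma eval_monEw F k (d : {fset (Var r)}) : (finsupp k `<=` d)%fset ->
  eval_mon F k = \prod_(v <- d) F v ^+ k v.
Proof.
move=> le; rewrite /eval_mon (big_fset_incl _ le) // => v _.
by rewrite -cmE_eq0 => /eqP ->; rewrite expr0.
Qed.

Lemma eval_mon_morphism F : mmorphism (eval_mon F).
Proof.
split=> [k1 k2|]; last by rewrite /eval_mon mdom1 big_seq_fset0.
rewrite {1}/eval_mon mdomD (eval_monEw _ _ _ (fsubsetUl _ (finsupp k2))).
rewrite (eval_monEw _ k2 _ (fsubsetUr (finsupp k1) _)) -big_split /=.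
by apply: eq_bigr => v _; rewrite cmM exprD.
Qed.

HB.instance Definition _ F := isMultiplicative.Build _ _ (eval_mon F) (eval_mon_morphism F).

(** Going through [mmap] makes this substitution a ring morphism; [evzE] recovers [evz] as the case
    where [F] lists the z_m^(j). *)
Definition eval F : Rg C r -> Rg C r := mmap (@malgC {cmonom (Var r)} C) (eval_mon F).

HB.instance Definition _ F := GRing.RMorphism.on (eval F).

Lemma evalC F c : eval F c%:MP = c%:MP. Proof. exact: mmapC. Qed.

Lemma evalZ F c p : eval F (c *: p) = c *: eval F p.
Proof. by rewrite /eval mmapZ mul_malgC. Qed.

Lemma eval_gvar F v : eval F (gvar C v) = F v.
Proof.
by rewrite /eval /gvar mmapU mul1r /eval_mon mdomU big_seq_fset1 cmUU.
Qed.

Lemma evzE (L : PDO C r) p : evz L p = eval (fun v => derivn v.2 (zz L v.1)) p.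
Proof. by apply: eq_bigr => k _; rewrite mul_malgC. Qed.

Lemma ucm_divcm k v : v \in finsupp k -> mmul (divcm k (ucm v)) (ucm v) = k.
Proof.
move=> kv; apply/eqP/cmP => w; rewrite cmM divcmE cmU.
by case: eqP => [<-|_]; rewrite ?addn0 ?subn0 // subnK // lt0n cmE_neq0.
Qed.

(** Induction on the degree of a monomial, one variable being split off by [ucm_divcm]. It lets
    facts about derivations and morphisms be checked on generators. *)
Lemma Rg_ind (S : Rg C r -> Prop) :
  (forall c, S c%:MP) -> (forall v, S (gvar C v)) ->
  (forall p q, S p -> S q -> S (p + q)) ->
  (forall p q, S p -> S q -> S (p * q)) -> forall p, S p.
Proof.
move=> SC Sv SD SM p.
have S1 : S 1 by rewrite -mpolyC1E.
have Smon n k : mdeg k = n -> S (mon k).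
  elim: n k => [|n IH] k kn.
    by move/eqP: kn; rewrite mdeg_eq0 => /eqP ->; rewrite mon1.
  have [v kv] : exists v, v \in finsupp k.
    by apply/fset0Pn/negP => /eqP k0; move: kn; rewrite mdegE k0 big_seq_fset0.
  rewrite -(ucm_divcm _ _ kv) monM; apply: SM; last exact: Sv.
  by apply: IH; move: kn; rewrite -{1}(ucm_divcm _ _ kv) mdegM mdegU addn1 => -[].
elim/mon_ind: p => [k|c p Sp|p q Sp Sq]; [exact: Smon | | exact: SD].
by rewrite -mul_malgC; exact: (SM _ _ (SC c) Sp).
Qed.
End Evaluation.

(** * The Leibniz rule for the derivation of R *)

Section Derivation.
Variables (C : numClosedFieldType) (r : nat).
Implicit Types (k : cmonom (Var r)) (p : Rg C r).

Lemma derivE p : deriv p = mmap (@malgC {cmonom (Var r)} C) (@dmon C r) p.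
Proof. by apply: eq_bigr => k _; rewrite mul_malgC. Qed.

Lemma derivD p q : deriv (p + q) = deriv p + deriv q.
Proof. by rewrite !derivE mmapD. Qed.

Lemma deriv0 : deriv (0 : Rg C r) = 0. Proof. by rewrite derivE mmap0. Qed.

Lemma deriv_mon k : deriv (mon C r k) = dmon C k.
Proof. by rewrite derivE mmapU mul1r. Qed.

Lemma derivZ c p : deriv (c *: p) = c *: deriv p.
Proof.
rewrite derivE (mmapEw (msuppZ_le c p)) derivE mmapE -[RHS]mul_malgC [RHS]mulr_sumr.
by apply: eq_bigr => k _; rewrite mcoeffZ /= mpolyCM mulrA.
Qed.

Lemma dmonEw k (d : {fset (Var r)}) : (finsupp k `<=` d)%fset ->
  dmon C k = \sum_(v <- d)
     (k v)%:R * (mon C r (divcm k (ucm v)) * gvar C (v.1, v.2.+1)).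
Proof.
move=> le; rewrite /dmon (big_fset_incl _ le) // => v _.
by rewrite -cmE_eq0 => /eqP ->; rewrite mul0r.
Qed.

Lemma divcm_mull k1 k2 v : v \in finsupp k1 ->
  divcm (mmul k1 k2) (ucm v) = mmul (divcm k1 (ucm v)) k2.
Proof.
move=> kv; apply/eqP/cmP => w; rewrite !(cmM, divcmE) cmU.
by case: eqP => [<-|_]; rewrite ?subn0 // addnBAC // lt0n cmE_neq0.
Qed.

Lemma dmonM k1 k2 :
  dmon C (mmul k1 k2) = dmon C k1 * mon C r k2 + mon C r k1 * dmon C k2.
Proof.
rewrite (dmonEw _ _ (fsubset_refl _)) mdomD (dmonEw k1 _ (fsubsetUl _ (finsupp k2))).
rewrite (dmonEw k2 _ (fsubsetUr (finsupp k1) _)) mulr_suml [X in _ + X]mulr_sumr.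
rewrite -big_split /=; apply: eq_bigr => v _.
rewrite (cmM v k1 k2) natrD (mulrDl (k1 v)%:R).
(* If v does not occur in k, the truncated division [divcm] may give the wrong monomial, but the
   weight k v is then zero. *)
have step k k' : (k v)%:R * (mon C r (divcm (mmul k k') (ucm v)) * gvar C (v.1, v.2.+1))
    = (k v)%:R * (mon C r (divcm k (ucm v)) * gvar C (v.1, v.2.+1) * mon C r k').
  case: (mdomP k v) => kv; last by rewrite [LHS]mul0r [RHS]mul0r.
  rewrite (divcm_mull _ _ _ kv) monM.
  by move: (mon _ _ _) (mon _ _ _) (gvar _ _) (_%:R) => x y z n; ring.
have := step k2 k1; rewrite (mulmC k2 k1); move: (step k1 k2) => {step}.
move: (mon C r (divcm (mmul k1 k2) _)) (mon C r (divcm k1 _)) (mon C r (divcm k2 _)).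
move: (mon C r k1) (mon C r k2) (gvar _ _) (k1 v)%:R (k2 v)%:R.
by move=> x1 x2 g n1 n2 y y1 y2 E1 E2; apply: etrans (congr2 +%R E1 E2) _; ring.
Qed.

Lemma derivM p q : deriv (p * q) = deriv p * q + p * deriv q.
Proof.
elim/mon_ind: p => [k|c p IH|p p' IH IH'].
- elim/mon_ind: q => [k'|c q IH|q q' IH IH'].
  + have := etrans (deriv_mon (mmul k k')) (dmonM k k').
    move: (deriv_mon k) (deriv_mon k') (monM C r k k').
    move: (mon C r (mmul k k')) (mon C r k) (mon C r k') (dmon C k) (dmon C k').
    by move=> xy x y dx dy -> -> <- ->.
  + apply: etrans (congr1 (@deriv C r) (esym (scalerAr c (mon C r k) q))) _.
    apply: etrans (derivZ c _) _; apply: etrans (congr1 _ IH) _.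
    move: (deriv (mon C r k)) (deriv q) (deriv (c *: q)) (derivZ c q) => d d' _ ->.
    by rewrite scalerDr -!scalerAr.
  + apply: etrans (congr1 (@deriv C r) (mulrDr (mon C r k) q q')) _.
    apply: etrans (derivD _ _) _; apply: etrans (congr2 _ IH IH') _.
    move: (deriv (mon C r k)) (deriv q) (deriv q') (deriv (q + q')) (derivD q q').
    by move=> d d1 d2 _ ->; ring.
- apply: etrans (congr1 (@deriv C r) (esym (scalerAl c p q))) _.
  apply: etrans (derivZ c _) _; apply: etrans (congr1 _ IH) _.
  move: (deriv p) (deriv q) (deriv (c *: p)) (derivZ c p) => d d' _ ->.
  by rewrite -!mul_malgC; move: (c%:MP) => a; ring.
- apply: etrans (congr1 (@deriv C r) (mulrDl p p' q)) _.
  apply: etrans (derivD _ _) _; apply: etrans (congr2 _ IH IH') _.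
  move: (deriv q) (deriv p) (deriv p') (deriv (p + p')) (derivD p p').
  by move=> d d1 d2 _ ->; ring.
Qed.

Lemma derivC (c : C) : deriv (c%:MP : Rg C r) = 0.
Proof. by rewrite derivE mmapU /dmon mdom1 big_seq_fset0 mulr0. Qed.

Lemma deriv_gvar v : deriv (gvar C v) = gvar C (v.1, v.2.+1) :> Rg C r.
Proof.
rewrite [LHS]deriv_mon /dmon mdomU big_seq_fset1 cmUU mul1r.
suff -> : divcm (ucm v) (ucm v) = mone by rewrite [<< _ >>]mpolyC1E mul1r.
by apply/eqP/cmP => w; rewrite divcmE subnn cm1.
Qed.
End Derivation.

(** * Products of operators as twisted convolutions *)

Section TwistedProduct.
Variables (A : comNzRingType) (op : nat -> nat -> A -> A).
Implicit Types (a b : nat -> A).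

(* The product of two operators, coefficients being listed from the top degree
   down; [op p l x] stands for binom(deg - p, l) D^l x. *)
Definition tmul a b n : A :=
  \sum_(p < n.+1) \sum_(q < (n - p).+1) a p * op p (n - p - q)%N (b q).

(** A monic operator whose declared degree exceeds its true degree by m. *)
Definition leads m a := (forall i, (i < m)%N -> a i = 0) /\ a m = 1.

Hypotheses (op_id : forall p x, op p 0 x = x) (op_zero : forall p l, op p l 0 = 0).

(** Turns one distinguished term into a double sum, so that it can be compared with [tmul] term by
    term. *)
Lemma sum_triangle_delta n i j (x : A) : (i + j <= n)%N ->
  \sum_(p < n.+1) \sum_(q < (n - p).+1) (if (p == i :> nat) && (q == j :> nat) then x else 0) = x.
Proof.
move=> ijn; have i_n : (i < n.+1)%N by lia.
rewrite (bigD1 (Ordinal i_n)) //= [X in _ + X]big1 ?addr0; last first.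
  by move=> p; rewrite -val_eqE /= => /negPf pi; rewrite big1 // => q _; rewrite pi.
have j_n : (j < (n - i).+1)%N by lia.
rewrite (bigD1 (Ordinal j_n)) //= !eqxx big1 ?addr0 // => q.
by rewrite -val_eqE /= => /negPf ->.
Qed.

Lemma tmul_leads m n a b : leads m a -> leads n b -> leads (m + n) (tmul a b).
Proof.
move=> [a0 am] [b0 bn]; split=> [i i_mn|].
  rewrite /tmul big1 // => p _; rewrite big1 // => q _.
  have [/a0 -> |mp] := ltnP p m; first by rewrite mul0r.
  by rewrite b0 ?op_zero ?mulr0 //; have := ltn_ord p; have := ltn_ord q; lia.
rewrite -[RHS](@sum_triangle_delta (m + n) m n) //.
apply: eq_bigr => p _; apply: eq_bigr => q _.
move: (nat_of_ord q) (ltn_ord q) => {}q qN; move: (nat_of_ord p) (ltn_ord p) qN => {}p pN qN.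
have [pm|] := eqVneq p m => [|pm] /=.
  rewrite pm am mul1r; have [->|qn] := eqVneq q n.
    by rewrite addKn subnn op_id bn.
  by rewrite b0 ?op_zero //; lia.
have [/a0 -> |mp] := ltnP p m; first by rewrite mul0r.
by rewrite b0 ?op_zero ?mulr0 //; lia.
Qed.

Variable T : A -> Prop.
Hypotheses (TD : forall x y, T x -> T y -> T (x + y)) (T0 : T 0)
  (TM : forall x y, T x -> T y -> T (x * y)) (Top : forall p l x, T x -> T (op p l x)).

(** The pairs (p, q) = (m+k, n) and (m, n+k) produce the two subtracted coefficients. Every other
    nonzero term has m <= p < m+k and n <= q < n+k, apart from the leading 1's, so it involves only
    earlier coefficients. *)
Lemma tmul_triangular m n k a b : leads m a -> leads n b -> (0 < k)%N ->
  (forall i, (i < k)%N -> T (a (m + i)%N)) -> (forall i, (i < k)%N -> T (b (n + i)%N)) ->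
  T (tmul a b (m + n + k)%N - (a (m + k)%N + b (n + k)%N)).
Proof.
move=> [a0 am] [b0 bn] k0 Ta Tb; set N := (m + n + k)%N.
rewrite -(@sum_triangle_delta N (m + k) n (a (m + k)%N)); last by rewrite /N; lia.
rewrite -(@sum_triangle_delta N m (n + k) (b (n + k)%N)); last by rewrite /N; lia.
rewrite -big_split -sumrB /=; elim/big_ind: _ => // p _.
rewrite -big_split -sumrB /=; elim/big_ind: _ => // q _.
move: (nat_of_ord q) (ltn_ord q) => {}q qN; move: (nat_of_ord p) (ltn_ord p) qN => {}p pN qN.
have [pm|mp] := ltnP p m.
  by rewrite a0 // mul0r !ifF ?addr0 ?subr0 //; apply/negbTE; lia.
have [qn|nq] := ltnP q n.
  by rewrite b0 // op_zero mulr0 !ifF ?addr0 ?subr0 //; apply/negbTE; lia.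
have [pmk|pmk] := eqVneq p (m + k)%N.
  have qE : q = n by lia.
  rewrite pmk qE bn (_ : _ - _ - _ = 0)%N; last by rewrite /N; lia.
  rewrite op_id mulr1 eqxx /= ifF ?addr0 ?subrr //; apply/negbTE; lia.
have [pm|pm] := eqVneq p m.
  rewrite pm am mul1r /= add0r; have [qE|qE] := eqVneq q (n + k)%N.
    by rewrite qE (_ : _ - _ - _ = 0)%N ?op_id ?subrr //; rewrite /N; lia.
  by rewrite subr0 -(subnKC nq); apply/Top/Tb; lia.
rewrite addr0 subr0 -(subnKC nq) -(subnKC mp).
by apply: TM; [apply: Ta; lia | apply/Top/Tb; lia].
Qed.

(** When f kills all terms of positive order, only q = n - p survives and the product becomes an
    ordinary Cauchy product. *)
Lemma tmul_morph (B : comNzRingType) (f : {rmorphism A -> B}) a b n :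
  (forall p l x, f (op p l.+1 x) = 0) ->
  f (tmul a b n) = \sum_(i < n.+1) f (a i) * f (b (n - i)%N).
Proof.
move=> fop; rewrite /tmul rmorph_sum; apply: eq_bigr => p _.
rewrite rmorph_sum big_ord_recr /= subnn op_id rmorphM big1 ?add0r // => q _.
by rewrite rmorphM -(subnSK (ltn_ord q)) fop mulr0.
Qed.

Lemma tmul_leads_morph m n k (B : comNzRingType) (f : {rmorphism A -> B}) a b :
  (forall p l x, f (op p l.+1 x) = 0) -> leads m a -> leads n b ->
  f (tmul a b (m + n + k)%N) =
    \sum_(i < k.+1) f (a (m + i)%N) * f (b (n + (k - i))%N).
Proof.
move=> fop [a0 _] [b0 _]; rewrite tmul_morph //.
rewrite -(big_mkord xpredT (fun i => f (a i) * f (b (m + n + k - i)%N))).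
rewrite (@big_cat_nat _ _ _ m) //=; last by lia.
rewrite big_nat big1 ?add0r => [|i im]; last by rewrite a0 ?rmorph0 ?mul0r.
rewrite (@big_cat_nat _ _ _ (m + k).+1) /=; [|lia|lia].
rewrite [X in _ + X]big_nat [X in _ + X]big1 ?addr0 => [|i im]; last first.
  by rewrite b0 ?rmorph0 ?mulr0 //; lia.
rewrite -{1}[m]addn0 -addnS [in X in \sum_(X <= _ < _) _]addnC big_addn addKn big_mkord.
apply: eq_bigr => i _; rewrite addnC; congr (_ * f (b _)).
by have := ltn_ord i; lia.
Qed.
End TwistedProduct.

(** * Powers of pseudodifferential operators *)

Section Powers.
Variables (C : numClosedFieldType) (r : nat).
Implicit Types (A B : PDO C r) (x y : Rg C r).

Definition twist A (p l : nat) x : Rg C r := binomZ C (pdeg A - p%:Z) l *: Dapp l x.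

Lemma twist_id A p x : twist A p 0 x = x.
Proof. by rewrite /twist /binomZ big_ord0 fact0 divr1 scale1r /Dapp expr0 scale1r. Qed.

Lemma derivn0 l : derivn l (0 : Rg C r) = 0.
Proof. by elim: l => //= l ->; exact: deriv0. Qed.

Lemma twist_zero A p l : twist A p l 0 = 0.
Proof. by rewrite /twist /Dapp derivn0 !scaler0. Qed.

Lemma pcoef_pmul A B : pcoef (pmul A B) = tmul _ (twist A) (pcoef A) (pcoef B).
Proof. by []. Qed.

Lemma pdeg_ppow A k : pdeg (ppow A k) = pdeg A *+ k.
Proof. by elim: k => [|k IH]; rewrite ?mulr0n // mulrS -IH. Qed.

Variables (A : PDO C r) (e : nat).
Hypothesis Ae : leads _ e (pcoef A).

Lemma ppow_leads k : leads _ (k * e) (pcoef (ppow A k)).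
Proof.
elim: k => [|k IH]; first by [].
by rewrite mulSn; exact: tmul_leads (twist_id A) (twist_zero A) _ _ _ _ Ae IH.
Qed.

Variable T : Rg C r -> Prop.
Hypotheses (TD : forall x y, T x -> T y -> T (x + y)) (TC : forall c, T c%:MP)
  (TM : forall x y, T x -> T y -> T (x * y)) (Td : forall x, T x -> T (deriv x)).

Lemma closedZ c x : T x -> T (c *: x).
Proof. by move=> Tx; rewrite -mul_malgC; exact: (TM _ _ (TC c) Tx). Qed.

Lemma closedN x : T x -> T (- x).
Proof. by rewrite -scaleN1r; exact: closedZ. Qed.

Lemma closedB x y : T x -> T y -> T (x - y).
Proof. by move=> Tx Ty; exact: (TD _ _ Tx (closedN _ Ty)). Qed.

Lemma closed0 : T 0. Proof. by rewrite -malgC0E. Qed.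

Lemma closed1 : T 1. Proof. by rewrite -mpolyC1E. Qed.

Lemma closed_twist B p l x : T x -> T (twist B p l x).
Proof.
move=> Tx; apply/closedZ/closedZ; rewrite /derivn.
by elim: l => //= l IH; exact: Td.
Qed.

(** Each of the k factors contributes its n-th coefficient once, against leading 1's; the rest
    involves earlier coefficients. This makes it possible to solve for the coefficients recursively,
    [T] being later the differential polynomials in the z_m. *)
Lemma ppow_triangular k n : (forall i, (i < n)%N -> T (pcoef A (e + i)%N)) ->
  (0 < n)%N -> T (pcoef (ppow A k) (k * e + n)%N - k%:R *: pcoef A (e + n)%N).
Proof.
elim: k n => [|k IH] n TA n0.
  rewrite mul0n add0n scale0r subr0 /ppow /= /pone /= gtn_eqF //; exact: closed0.
have Tk i : (i < n)%N -> T (pcoef (ppow A k) (k * e + i)%N).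
  case: i => [|i] i_n; first by rewrite addn0 (ppow_leads k).2; exact: closed1.
  rewrite -(subrK (k%:R *: pcoef A (e + i.+1)%N) (pcoef _ _)); apply: TD.
    by apply: IH => // j ji; apply: TA; apply: ltn_trans i_n.
  by apply: closedZ; exact: TA.
have := tmul_triangular _ _ (twist_id A) (twist_zero A) T TD closed0 TM (closed_twist A)
  _ _ _ _ _ Ae (ppow_leads k) n0 TA Tk.
rewrite -pcoef_pmul -mulSn => TS.
suff -> : pcoef (ppow A k.+1) (k.+1 * e + n)%N - k.+1%:R *: pcoef A (e + n)%N =
    pcoef (pmul A (ppow A k)) (k.+1 * e + n)%N
      - (pcoef A (e + n)%N + pcoef (ppow A k) (k * e + n)%N)
    + (pcoef (ppow A k) (k * e + n)%N - k%:R *: pcoef A (e + n)%N).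
  by apply: TD => //; exact: IH.
rewrite -[pcoef (ppow A k.+1)]/(pcoef (pmul A (ppow A k))) -natr1 scalerDl scale1r.
move: (pcoef (pmul _ _) _) (pcoef (ppow _ _) _) (pcoef A _) (k%:R *: _) => x y z t.
by ring.
Qed.
End Powers.

(** * Normal form of the root and positions of its coefficients *)

Section Root.
Variables (C : numClosedFieldType) (r : nat) (L : PDO C r) (hL : is_Qroot L).

(* [is_Qroot] allows [pdeg L] to exceed 1, with e vanishing leading coefficients. *)
Lemma Qroot_normal : exists e : nat,
  [/\ pdeg L = e.+1%:Z, leads _ e (pcoef L) & pcoef L e.+1 = 0].
Proof.
case: hL => L1 L0 _.
have d1 : 1 <= pdeg L.
  move: L1; rewrite /Defs.coefZ; case: ifP => // _ /eqP.
  by rewrite eq_sym oner_eq0.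
have [e eE] : exists e : nat, pdeg L = e.+1%:Z by exists `|pdeg L - 1|%N; lia.
have coefL (n : nat) : coefZ L (e.+1%:Z - n%:Z) = pcoef L n.
  by rewrite /Defs.coefZ eE ifT; [congr pcoef; lia | lia].
exists e; split=> //; last by rewrite -coefL subrr L0.
split=> [i ie|]; first by rewrite -coefL L0 //; lia.
by rewrite -coefL -L1; congr coefZ; lia.
Qed.

Variable e : nat.
Hypotheses (Ldeg : pdeg L = e.+1%:Z) (Llead : leads _ e (pcoef L)).

(** The declared degree of L^k is k(e+1), so D^(-1) sits at position k(e+1) + 1; the part k e is the
    accumulated excess of degree. *)
Lemma res_ppow k : res (ppow L k) = pcoef (ppow L k) (k * e + k.+1).
Proof.
have deg : pdeg (ppow L k) = (e.+1 * k)%N%:Z by rewrite pdeg_ppow Ldeg -mulr_natr natz.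
have le1 : -1 <= pdeg (ppow L k) by rewrite deg.
by rewrite /res /Defs.coefZ le1 deg; congr pcoef; lia.
Qed.

Lemma pcoef_root_pow n : pcoef (ppow L r) (r * e + n) = pcoef (Qop C r) n.
Proof.
case: hL => _ _ /(_ (r%:Z - n%:Z)).
have deg : pdeg (ppow L r) = (e.+1 * r)%N%:Z by rewrite pdeg_ppow Ldeg -mulr_natr natz.
have le1 : r%:Z - n%:Z <= pdeg (ppow L r) by rewrite deg; lia.
have le2 : r%:Z - n%:Z <= pdeg (Qop C r) by rewrite /=; lia.
rewrite /Defs.coefZ le1 le2 deg => H.
rewrite (_ : (r * e + n)%N = absz ((e.+1 * r)%N%:Z - (r%:Z - n%:Z))%R); last by lia.
by rewrite H; congr pcoef; rewrite /=; lia.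
Qed.
End Root.

(** * Expressions with a derivative in every monomial *)

Section Ideal.
Variables (C : numClosedFieldType) (r : nat).
Implicit Types (P Q x y : Rg C r).

Definition derivative_ideal P :=
  forall k, k \in msupp P -> exists v : Var r, (0 < v.2)%N /\ (0 < k v)%N.

Lemma derivative_ideal0 : derivative_ideal 0.
Proof. by move=> k; rewrite msupp0. Qed.

Lemma derivative_idealD P Q :
  derivative_ideal P -> derivative_ideal Q -> derivative_ideal (P + Q).
Proof.
move=> JP JQ k /(fsubsetP (msuppD_le _ _)); rewrite in_fsetU.
by case/orP; [exact: JP | exact: JQ].
Qed.

Lemma derivative_idealM P Q : derivative_ideal P -> derivative_ideal (P * Q).
Proof.
move=> JP k /msuppM_le [k1 [k2 [/JP [v [v0 kv]] _ ->]]].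
by exists v; split=> //; rewrite cmM; apply: leq_trans kv _; exact: leq_addr.
Qed.

Lemma derivative_ideal_gvar v : (0 < v.2)%N -> derivative_ideal (gvar C v).
Proof.
by move=> v0 k /(fsubsetP msuppU_le); rewrite in_fset1 => /eqP ->; exists v; rewrite cmUU.
Qed.

Variable F : Var r -> Rg C r.
Hypothesis FS : forall v, deriv (F v) = F (v.1, v.2.+1).

(** With [F] the family z_m^(j), these are the images under substitution of the whole ring and of
    [derivative_ideal]. *)
Definition inZ x := exists P, x = eval C r F P.
Definition inZder x := exists P, derivative_ideal P /\ x = eval C r F P.

Lemma inZD x y : inZ x -> inZ y -> inZ (x + y).
Proof. by move=> [P ->] [Q ->]; exists (P + Q); rewrite (rmorphD (eval C r F)). Qed.

Lemma inZM x y : inZ x -> inZ y -> inZ (x * y).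
Proof. by move=> [P ->] [Q ->]; exists (P * Q); rewrite (rmorphM (eval C r F)). Qed.

Lemma inZC c : inZ c%:MP.
Proof. by exists c%:MP; rewrite evalC. Qed.

Lemma inZder0 : inZder 0.
Proof.
by exists 0; split; [exact: derivative_ideal0 | rewrite (rmorph0 (eval C r F))].
Qed.

Lemma inZderD x y : inZder x -> inZder y -> inZder (x + y).
Proof.
move=> [P [JP ->]] [Q [JQ ->]]; exists (P + Q).
by rewrite (rmorphD (eval C r F)); split=> //; exact: derivative_idealD.
Qed.

Lemma inZderM x y : inZder x -> inZ y -> inZder (x * y).
Proof.
move=> [P [JP ->]] [Q ->]; exists (P * Q).
by rewrite (rmorphM (eval C r F)); split=> //; exact: derivative_idealM.
Qed.

(** On a generator, [FS] raises the derivative order to at least 1; the Leibniz rule and the ideal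
    property do the rest. *)
Lemma deriv_inZ x : inZ x -> inZder (deriv x).
Proof.
case=> P ->; elim/Rg_ind: P => [c|v|P Q IP IQ|P Q IP IQ].
- by rewrite evalC derivC; exact: inZder0.
- rewrite eval_gvar FS; exists (gvar C (v.1, v.2.+1)).
  by split; [exact: derivative_ideal_gvar | rewrite eval_gvar].
- by rewrite (rmorphD (eval C r F)) derivD; exact: (inZderD _ _ IP IQ).
- rewrite (rmorphM (eval C r F)) derivM; apply: inZderD; last first.
    by rewrite mulrC; apply: (inZderM _ _ IQ); exists P.
  by apply: (inZderM _ _ IP); exists Q.
Qed.

Lemma inZder_inZ x : inZder x -> inZ x.
Proof. by case=> P [_ ->]; exists P. Qed.
End Ideal.

(** * Setting all derivatives of the gamma_i to zero *)

Section Specialize.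
Variables (C : numClosedFieldType) (r : nat).

Definition dispersionless : Rg C r -> Rg C r :=
  eval C r (fun v => if v.2 == 0%N then gvar C v else 0).

HB.instance Definition _ := GRing.RMorphism.on dispersionless.

Lemma dispersionless0 : dispersionless 0 = 0.
Proof. exact: (rmorph0 (eval C r _)). Qed.

Lemma dispersionlessD x y : dispersionless (x + y) = dispersionless x + dispersionless y.
Proof. exact: (rmorphD (eval C r _)). Qed.

Lemma dispersionlessM x y : dispersionless (x * y) = dispersionless x * dispersionless y.
Proof. exact: (rmorphM (eval C r _)). Qed.

Lemma dispersionlessZ c x : dispersionless (c *: x) = c *: dispersionless x.
Proof. exact: evalZ. Qed.

Lemma dispersionless_deriv x : dispersionless (deriv x) = 0.
Proof.
elim/Rg_ind: x => [c|v|x y IH IH'|x y IH IH'].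
- by rewrite derivC dispersionless0.
- by rewrite deriv_gvar /dispersionless eval_gvar.
- by rewrite derivD dispersionlessD; exact: etrans (congr2 +%R IH IH') (addr0 _).
- apply: etrans (congr1 dispersionless (derivM C r x y)) _.
  apply: etrans (dispersionlessD _ _) _.
  apply: etrans (congr2 +%R (dispersionlessM _ _) (dispersionlessM _ _)) _.
  apply: etrans (congr2 (fun s t => s * dispersionless y + dispersionless x * t) IH IH') _.
  exact: etrans (congr2 +%R (mul0r _) (mulr0 _)) (addr0 _).
Qed.

Lemma dispersionless_twist (A : PDO C r) p l x : dispersionless (twist C r A p l.+1 x) = 0.
Proof.
by rewrite /twist /Dapp !dispersionlessZ /= dispersionless_deriv !scaler0.
Qed.

(** Each gamma_i^(j+1) is the derivative of an element expressible through [F], so [deriv_inZ]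
    applies to it. In particular every element killed by [dispersionless] satisfies [inZder]. *)
Lemma sub_dispersionless F : (forall v, deriv (F v) = F (v.1, v.2.+1)) ->
  (forall x, inZ C r F x) -> forall x, inZder C r F (x - dispersionless x).
Proof.
move=> FS allZ; elim/Rg_ind => [c|[o j]|x y IH IH'|x y IH IH'].
- by rewrite /dispersionless evalC subrr; exact: inZder0.
- rewrite /dispersionless eval_gvar; case: j => [|j] /=; first by rewrite subrr; exact: inZder0.
  by rewrite subr0 -(deriv_gvar C r (o, j)); apply: deriv_inZ.
- by rewrite dispersionlessD opprD addrACA; exact: (inZderD _ _ _ _ _ IH IH').
rewrite dispersionlessM; move: (dispersionless x) (dispersionless y) IH IH'.
move=> x' y' IH IH'.
have -> : x * y - x' * y' = (x - x') * y + (y - y') * x' by ring.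
by apply: inZderD; [exact: (inZderM _ _ _ _ _ IH (allZ y)) | exact: (inZderM _ _ _ _ _ IH' (allZ x'))].
Qed.
End Specialize.

(** * The z_m generate R as a differential algebra *)

Section Generation.
Variables (C : numClosedFieldType) (r : nat) (hr : (2 <= r)%N) (L : PDO C r).
Hypothesis hL : is_Qroot L.
Variable e : nat.
Hypotheses (Ldeg : pdeg L = e.+1%:Z) (Llead : leads _ e (pcoef L)) (L1 : pcoef L e.+1 = 0).

Let F (v : Var r) := derivn v.2 (zz L v.1).
Let Z := inZ C r F.

Lemma derivn_succ v : deriv (F v) = F (v.1, v.2.+1). Proof. by []. Qed.

Let ZD : forall x y, Z x -> Z y -> Z (x + y) := inZD C r F.
Let ZM : forall x y, Z x -> Z y -> Z (x * y) := inZM C r F.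
Let ZC : forall c, Z c%:MP := inZC C r F.

Lemma inZ_deriv x : Z x -> Z (deriv x).
Proof. by move=> Zx; apply: inZder_inZ; apply: deriv_inZ. Qed.

Lemma inZ_zz (m : nat) : (m < r.-1)%N -> Z (zz L m).
Proof. by move=> mr; exists (gvar C (Ordinal mr, 0%N)); rewrite eval_gvar. Qed.

(** Position e + m + 2 holds the coefficient w of D^(-m-1). By [ppow_triangular] the residue of
    L^(m+1), a nonzero multiple of z_m, is (m+1) w plus earlier terms. The range m <= r-2 gives the
    bound n <= r. *)
Lemma inZ_root n : (n <= r)%N -> Z (pcoef L (e + n)%N).
Proof.
elim/ltn_ind: n => -[|[|m]] IH mr.
- by rewrite addn0 Llead.2; exact: (closed1 _ _ _ ZC).
- by rewrite addn1 L1; exact: (closed0 _ _ _ ZC).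
have m_r : (m < r.-1)%N by lia.
have IH' i : (i < m.+2)%N -> Z (pcoef L (e + i)%N) by move=> i_m; apply: IH => //; lia.
have := ppow_triangular _ _ _ _ Llead Z ZD ZC ZM inZ_deriv m.+1 _ IH' isT.
have := inZ_zz _ m_r; rewrite /zz (res_ppow _ _ _ _ Ldeg) //.
move: (pcoef (ppow _ _) _) (pcoef L _) => x y Zx Zy.
have Zx' : Z x.
  have c0 : (- (r%:R / m.+1%:R) : C) != 0.
    by rewrite oppr_eq0 mulf_neq0 ?invr_eq0 ?pnatr_eq0 //; lia.
  rewrite -[x]scale1r -(mulVf c0) -scalerA; exact: (closedZ _ _ _ ZC ZM).
have -> : y = m.+1%:R^-1 *: (x - (x - m.+1%:R *: y)).
  by rewrite subKr scalerA mulVf ?scale1r // pnatr_eq0.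
by apply: (closedZ _ _ _ ZC ZM); apply: (closedB _ _ _ ZD ZC ZM).
Qed.

Lemma inZ_root_pow k n : (n <= r)%N -> Z (pcoef (ppow L k) (k * e + n)%N).
Proof.
case: n => [|n] nr.
  by rewrite addn0 (ppow_leads _ _ _ _ Llead k).2; exact: (closed1 _ _ _ ZC).
have TA i : (i < n.+1)%N -> Z (pcoef L (e + i)%N) by move=> i_n; apply: inZ_root; lia.
have := ppow_triangular _ _ _ _ Llead Z ZD ZC ZM inZ_deriv k _ TA isT.
have := inZ_root _ nr.
move: (pcoef (ppow _ _) _) (pcoef L _) => x y Zy Zx.
rewrite -(subrK (k%:R *: y) x); apply: ZD => //.
exact: (closedZ _ _ _ ZC ZM).
Qed.

Lemma inZ_all x : Z x.
Proof.
elim/Rg_ind: x => [c|[o j]|x y Zx Zy|x y Zx Zy]; last 2 first.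
- exact: (ZD _ _ Zx Zy).
- exact: (ZM _ _ Zx Zy).
- exact: ZC.
elim: j => [|j IH]; last by rewrite -(deriv_gvar C r (o, j)); exact: inZ_deriv.
(* In L^r = Q, gamma_o is the coefficient r - o places below the leading one, within the range n <=
   r already treated. *)
have := inZ_root_pow r (r - o) (leq_subr _ _).
rewrite (pcoef_root_pow _ _ _ hL _ Ldeg) /=.
have or := ltn_ord o; rewrite ifF; last by apply/negbTE; lia.
rewrite ifT; last by lia.
by rewrite subKn; [rewrite /gamma valK | lia].
Qed.
End Generation.

(** * The commutative symbol of the root *)

Section Symbol.
Variables (C : numClosedFieldType) (r : nat) (hr : (2 <= r)%N) (L : PDO C r).
Hypothesis hL : is_Qroot L.
Variable e : nat.
Hypotheses (Ldeg : pdeg L = e.+1%:Z) (Llead : leads _ e (pcoef L)) (L1 : pcoef L e.+1 = 0).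

Let phi := dispersionless C r.
Let g : {poly (Rg C r)} := \poly_(i < r.+3) phi (pcoef L (e + i)).

Lemma symbol_ppow k n : (n < r.+3)%N ->
  phi (pcoef (ppow L k) (k * e + n)) = (g ^+ k)`_n.
Proof.
elim: k n => [|k IH] n nr.
  rewrite mul0n add0n expr0 coef1 /= /pone /=; case: eqP => _.
    exact: (rmorph1 (eval C r _)).
  exact: dispersionless0.
rewrite mulSn -[ppow L k.+1]/(pmul L (ppow L k)) pcoef_pmul.
apply: etrans (tmul_leads_morph _ _ (twist_id _ _ L) _ _ _ _ phi _ _
  (dispersionless_twist C r L) Llead (ppow_leads _ _ _ _ Llead k)) _.
rewrite exprS coefM; apply: eq_bigr => i _.
have i_n := ltn_ord i; rewrite coef_poly ifT; last by lia.
by congr (_ * _); apply: IH; lia.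
Qed.

Lemma dispersionless_identity :
  phi (((r ^ 2)%:R / (r.+1)%:R : C) *: res (ppow L r.+1)
      - 2^-1 *: (\sum_(j < r.-1) zz L j * zz L (r - 2 - j)%N)) = 0.
Proof.
have phires k : (k <= r.+1)%N -> phi (res (ppow L k)) = powres C _ g k.
  by move=> kr; rewrite (res_ppow _ _ _ _ Ldeg) symbol_ppow.
have phizz j : (j <= r)%N ->
    phi (zz L j) = - (r%:R / j.+1%:R : C) *: powres C _ g j.+1.
  by move=> jr; rewrite -phires // /zz; exact: dispersionlessZ.
have g0 : g`_0 = 1.
  by rewrite coef_poly addn0 Llead.2; exact: (rmorph1 (eval C r _)).
have g1 : g`_1 = 0 by rewrite coef_poly addn1 L1 /=; exact: dispersionless0.
have gr : (g ^+ r)`_r.+2 = 0.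
  rewrite -symbol_ppow // (pcoef_root_pow _ _ _ hL _ Ldeg) /= ifF; last by lia.
  exact: dispersionless0.
have Eres := etrans (dispersionlessZ C r ((r ^ 2)%:R / (r.+1)%:R) _)
  (congr1 _ (phires r.+1 (leqnn _))).
apply: etrans (rmorphB (eval C r _) _ _) _.
apply/eqP; rewrite subr_eq0; apply/eqP; apply: etrans Eres _.
apply: etrans (powres_pair _ _ _ g0 g1 _ hr gr) _.
apply: etrans (esym (dispersionlessZ C r 2^-1 _)); apply: congr1.
apply: etrans (esym (rmorph_sum phi _ _ _)); apply: eq_bigr => j _.
have j_r : (j <= r)%N by have := ltn_ord j; lia.
have j'_r : (r - 2 - j <= r)%N by lia.
apply: etrans (esym (dispersionlessM _ _ _ _)).
exact: esym (congr2 *%R (phizz _ j_r) (phizz _ j'_r)).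
Qed.
End Symbol.

Theorem theorem3p5 (C : numClosedFieldType) (r : nat) (hr : (2 <= r)%N)
  (L : PDO C r) (hL : is_Qroot L) :
  exists P : Rg C r,
    (forall k, k \in msupp P -> exists v : Var r, (0 < v.2)%N /\ (0 < k v)%N) /\
    ((r ^ 2)%:R / (r.+1)%:R : C) *: res (ppow L r.+1)
      = 2^-1 *: (\sum_(j < r.-1) zz L j * zz L (r - 2 - j)%N) + evz L P.
Proof.
have [e [Ldeg Llead L1]] := Qroot_normal C r L hL.
have Zall := inZ_all C r hr L hL e Ldeg Llead L1.
have [P [JP PE]] := sub_dispersionless C r _ (derivn_succ C r L) Zall
  (((r ^ 2)%:R / (r.+1)%:R : C) *: res (ppow L r.+1)
      - 2^-1 *: (\sum_(j < r.-1) zz L j * zz L (r - 2 - j)%N)).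
exists P; split=> //; rewrite evzE -PE (dispersionless_identity C r hr L hL e Ldeg Llead L1).
by rewrite subr0 addrC subrK.
Qed.
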